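(* Let $\kappa\in\mathbb{R}$, let $B\subseteq\mathbb{R}_+$ be a closed Lebesgue non-null set, and let $g:B\to\mathbb{R}_+$ be continuous and satisfy the restricted Cauchy functional equation $(ResCFE)$ on $B$ with exponent $\kappa$. (a) If $B$ is nowhere dense, then for almost all $b\in B$ there exists in $\mathbb{Q}$ a sequence $q_n=q_n(b)\to1$ with $q_nb\in B$ and $$g(q_nb)=q_n^{\kappa}g(b),\qquad\text{equivalently}\qquad g(bq_n(b))/(bq_n(b))^{\kappa}=g(b)/b^{\kappa},$$ i.e. $h(x):=g(x)/x^{\kappa}$ remains constant on the points of a rational sequence of dilations $q_n(b)$ of $b$. The sequence can be selected so that $q_{2n-1}(b)\downarrow1$ (strictly) and $q_{2n}(b)=1/q_{2n-1}(b)\uparrow1$. (b) If $B$ is somewhere dense, then $B=B_1\cup B_0$ with $B_1$ open and $B_0$ nowhere dense, such that the following hold. For every open interval $I$ that is a connected component of $B_1$: (i) there is $\lambda_0\in I$ such that, with $c:=g(\lambda_0)/\lambda_0^{\kappa}$, $g(\lambda)=c\lambda^{\kappa}$ for all $\lambda\in I$; (ii) if $f:\mathbb{R}_+\to\mathbb{R}_+$ is continuous, $\{x_n\}_{n\in\mathbb{N}}$ is a multiplicatively admissible sequence in $\mathbb{R}_+$ and $\{a_n\}_{n\in\mathbb{N}}$ is a positive sequence with $a_nf(\lambda x_n)\to g(\lambda)$ for each $\lambda\in I$, then $f$ is regularly varying with index $\kappa$, i.e. $f(x)\sim x^{\kappa}\ell(x)$ as $x\to\infty$ with $\ell$ slowly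 varying; (iii) in (ii), $a_n\sim c\,x_n^{-\kappa}/\ell(x_n)$. If $B_0$ is non-null, then the conclusion of (a) holds with $B_0$ in place of $B$ (and $g|B_0$ in place of $g$).
   Context: $\mathbb{R}_+:=(0,\infty)$. ''Almost all'' means off a Lebesgue-null set. Restricted Cauchy functional equation (measure version): for a measurable non-null set $B\subseteq\mathbb{R}_+$, a continuous function $g:B\to\mathbb{R}_+$ satisfies $(ResCFE)$ on $B$ with exponent $\kappa$ if for every $s>0$ such that $B\cap Bs^{-1}$ is non-null there is a null set $M(s)$ with $g(s\lambda)=s^{\kappa}g(\lambda)$ for all $\lambda\in(B\cap Bs^{-1})\setminus M(s)$. A sequence $\{c_n\}$ of positive reals with $\limsup_{n\to\infty}c_n=\infty$ is multiplicatively admissible if $\limsup_{n\to\infty}c_{n+1}/c_n=1$. A function $\ell:\mathbb{R}_+\to\mathbb{R}_+$ is slowly varying if $\ell(tx)/\ell(x)\to1$ as $x\to\infty$ for each $t>0$; $f$ is regularly varying with index $\kappa$ if $f(tx)/f(x)\to t^{\kappa}$ as $x\to\infty$ for each $t>0$. *)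

(* Defs.v *)
From HB Require Import structures.
From mathcomp Require Import all_boot all_order all_algebra.
From mathcomp Require Import all_classical all_reals all_analysis.

Set Implicit Arguments.
Unset Strict Implicit.
Unset Printing Implicit Defensive.

Import Order.TTheory GRing.Theory Num.Theory.
Import numFieldNormedType.Exports.

Local Open Scope classical_set_scope.
Local Open Scope ring_scope.

(* Functions with domain B or (0, oo) are total functions R -> R whose values
   outside the domain are never constrained. *)

(* Measurability of A is not built in: a set is null when it is contained in a
   measurable set of measure 0. *)
Definition lebesgue_null (R : realType) (A : set R) : Prop :=
  (@lebesgue_measure R).-negligible A.

(* B is a subset of (0, oo) which is closed in the topology of (0, oo). *)
Definition rel_closed_pos (R : realType) (B : set R) : Prop :=
  exists2 C : set R, closed C & B = `]0, +oo[ `&` C.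

Definition somewhere_dense (T : topologicalType) (A : set T) : Prop :=
  interior (closure A) !=set0.

Definition nowhere_dense (T : topologicalType) (A : set T) : Prop :=
  ~ somewhere_dense A.

Definition positive_on (R : realType) (D : set R) (f : R -> R) : Prop :=
  forall x : R, D x -> 0 < f x.

Definition ResCFE (R : realType) (kappa : R) (B : set R) (g : R -> R) : Prop :=
  forall s : R, 0 < s ->
    let D := B `&` [set b * s^-1 | b in B] in
    ~ lebesgue_null D ->
    exists2 M : set R, lebesgue_null M &
      forall l : R, (D `\` M) l -> g (s * l) = s `^ kappa * g l.

(* Limits superior are taken in the extended reals. *)
Definition mult_admissible (R : realType) (c : nat -> R) : Prop :=
  [/\ forall n : nat, 0 < c n,
      limn_esup (fun n : nat => (c n)%:E) = +oo%E
    & limn_esup (fun n : nat => (c n.+1 / c n)%:E) = 1%E].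

Definition slowly_varying (R : realType) (l : R -> R) : Prop :=
  positive_on `]0, +oo[ l /\
  forall t : R, 0 < t -> l (t * x) / l x @[x --> +oo] --> (1 : R).

Definition regularly_varying (R : realType) (kappa : R) (f : R -> R) : Prop :=
  forall t : R, 0 < t -> f (t * x) / f x @[x --> +oo] --> t `^ kappa.

(* f / h --> 1, the convention of regular variation; used for a positive h only. *)
Definition asymp_equiv (R : realType) (T : Type) (F : set_system T)
    (f h : T -> R) : Prop :=
  f y / h y @[y --> F] --> (1 : R).

(* q enumerates the sequence q_1, q_2, ... from index 0: q k.*2 is q_(2k+1) and
   q k.*2.+1 is q_(2k+2). *)
Definition rational_dilations (R : realType) (kappa : R) (B : set R)
    (g : R -> R) (b : R) (q : nat -> rat) : Prop :=
  let r := fun n : nat => ratr (q n) : R in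
  let h := fun x : R => g x / x `^ kappa in
  [/\ r n @[n --> \oo] --> (1 : R),
      forall n : nat, [/\ B (r n * b),
                          g (r n * b) = r n `^ kappa * g b
                        & h (b * r n) = h b],
      decreasing_seq (fun n : nat => q n.*2),
      increasing_seq (fun n : nat => q n.*2.+1)
    & forall n : nat, q n.*2.+1 = (q n.*2)^-1].

Definition constant_along_rational_dilations (R : realType) (kappa : R)
    (B : set R) (g : R -> R) : Prop :=
  {ae @lebesgue_measure R, forall b : R,
    B b -> exists q : nat -> rat, rational_dilations kappa B g b q}.

(* I is an open interval and a connected component of A. *)
Definition open_interval_component (R : realType) (A I : set R) : Prop :=
  [/\ open I, is_interval I & exists2 x : R, A x & I = connected_component A x].

(* Main.v *)
Require Import Defs.
From HB Require Import structures.
From mathcomp Require Import all_boot all_order all_algebra.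
From mathcomp Require Import all_classical all_reals all_analysis.
From mathcomp Require Import ring lra.

(** Part (a): for each rational s the functional equation fails only on a null
set, and the rationals are countable, so it suffices to show that almost every
b in B has q b and b / q in B for rationals q > 1 arbitrarily close to 1.
Otherwise the set E of exceptions (for some neighbourhood of 1) is non-null,
and then E, q E and E / q have a common point for q close to 1, a Steinhaus type
argument which contradicts the definition of E.

Part (b): take B1 to be the interior of B.  On an interval of B1 the functional
equation holds everywhere by continuity, hence g is c l^kappa there.  In the
coordinates u = ln x, h u = ln (f (e^u)) - kappa u, the hypothesis on f says that
h (t_n + u) + al_n tends to 0 for u in an interval.  By Baire this holds uniformly
up to e on a subinterval; as the gaps of the unbounded sequence t_n become small,
the translates of that subinterval cover a neighbourhood of +oo, so that h is
e-uniformly continuous there, and every y can be compared with some t_n + u. *)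

Set Implicit Arguments.
Unset Strict Implicit.
Unset Printing Implicit Defensive.

Import Order.TTheory GRing.Theory Num.Theory.
Import numFieldNormedType.Exports.

Local Open Scope classical_set_scope.
Local Open Scope ring_scope.

(** * Steinhaus property for dilations *)

(** The rescaled pushforward agrees with Lebesgue measure on half-open intervals; uniqueness does
    the rest. *)
Lemma lebesgue_measure_scale (R : realType) (s : R) (A : set R) : 0 < s ->
  measurable A ->
  (lebesgue_measure A = s%:E * lebesgue_measure (( *%R s) @^-1` A))%E.
Proof.
move=> s0 mA.
rewrite (@lebesgue_measure_unique R (mscale (NngNum (ltW s0))
  (pushforward lebesgue_measure
    ( *%R s : measurableTypeR R -> measurableTypeR R)))) // => _ [[a b]] _ <-.
change (lebesgue_measure `]a, b] =
  s%:E * lebesgue_measure ( *%R s @^-1` `]a, b]))%E.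
have -> : ( *%R s) @^-1` `]a, b] = `]s^-1 * a, s^-1 * b]%classic.
  apply/seteqP; split=> x /=; rewrite !in_itv /=.
    by rewrite ltr_pdivrMl // ler_pdivlMl.
  by rewrite ltr_pdivrMl // ler_pdivlMl.
rewrite !lebesgue_measure_itv /= !lte_fin ltr_pM2l ?invr_gt0 //.
case: ifPn => _; last by rewrite mule0.
rewrite -EFinM; congr EFin.
by field; apply: lt0r_neq0.
Qed.

(** By inner and outer regularity, [E] contains a compact [K] of measure m > 0, and [K] sits in an
    open [U] of measure below 5m/4. For [s] near 1 both s K and K / s stay in [U], so each misses
    less than half of [K], and some point of [K] lies in both. *)
Lemma nonnull_dilates_meet (R : realType) (E : set R) : measurable E ->
  lebesgue_measure E != 0%E ->
  \forall s \near (1 : R), exists x, [/\ E x, E (s * x) & E (s^-1 * x)].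
Proof.
move=> mE E0.
have [K [cK KE K0]] : exists K, [/\ compact K, K `<=` E &
    (0 < lebesgue_measure K)%E].
  apply: contrapT => nK; move/negP: E0; apply; apply/eqP/le_anti.
  rewrite measure_ge0 andbT lebesgue_regularity_inner_sup //.
  apply: ge_ereal_sup => _ [K [cK KE] <-]; rewrite leNgt; apply/negP => K0.
  by apply: nK; exists K.
have mK := measurable_realfun.compact_measurable cK.
have Koo := compact_finite_measure cK.
have [m m0 Km] : exists2 m : R, 0 < m & lebesgue_measure K = m%:E.
  exists (fine (lebesgue_measure K)); first by rewrite fine_gt0 ?K0.
  by rewrite fineK // ge0_fin_numE // ltW.
have m4 : 0 < m / 4 by rewrite divr_gt0.
have [U [oU KU Um]] := lebesgue_regularity_outer mK Koo m4.
have mU := measurable_realfun.open_measurable oU.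
have UKm : (lebesgue_measure U < (m + m / 4)%:E)%E.
  rewrite -(setDUK KU) measureU //.
  - by rewrite /= Km EFinD lteD2lE.
  - exact: measurableD.
  - by apply/seteqP; split=> x //= -[Kx [_]].
(* Tube lemma: compactness of [K] makes one neighbourhood of 1 serve all its points. *)
have tube : \forall s \near (1 : R), K `<=` [set x | U (s * x)].
  have /(_ R (nbhs (1 : R)) (fun s x => U (s * x)) _) :=
    (compact_near_coveringP K).1 cK.
  apply => x Kx.
  have : (fun z : R * R => z.2 * z.1) @
      filter_prod (nbhs (x : R)) (nbhs (1 : R)) --> (1 * x : R).
    apply: cvgM; [exact: cvg_snd|exact: cvg_fst].
  by apply; rewrite mul1r; apply: open_nbhs_nbhs; split => //; exact: KU.
(* K / s has measure m / s > 3m/4 and lies in [U], so less than 5m/4 - 3m/4 = m/2 remains. The range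
   of [s] is stable under inversion, so the estimate serves [s] and its inverse alike. *)
have key s : 3 / 4 < s < 4 / 3 -> K `<=` [set x | U (s^-1 * x)] ->
    (lebesgue_measure (K `\` ( *%R s @^-1` K)) < (m / 2)%:E)%E.
  move=> /andP[s34 s43] sKU.
  have s0 : 0 < s by lra.
  have mP : measurable ( *%R s @^-1` K : set (measurableTypeR R)).
    rewrite -[X in measurable X]setTI.
    exact: measurable_realfun.mulrl_measurable.
  have PU : ( *%R s @^-1` K) `<=` U.
    by move=> x /sKU /=; rewrite mulKf ?gt_eqF.
  have Kms := lebesgue_measure_scale s0 mK.
  apply: (@le_lt_trans _ _ (lebesgue_measure (U `\` ( *%R s @^-1` K)))).
    apply: le_measure; rewrite ?inE; [exact: measurableD|exact: measurableD|].
    exact: setSD.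
  rewrite measureD //; last by apply: lt_trans UKm _; rewrite ltry.
  rewrite (setIidr PU).
  move: Kms UKm; rewrite Km /=.
  have : (0 <= lebesgue_measure ( *%R s @^-1` K))%E by exact: measure_ge0.
  have : (0 <= lebesgue_measure U)%E by exact: measure_ge0.
  case: (lebesgue_measure U) => [u| |] //; case: (lebesgue_measure _) => [p| |] //.
    move=> _ _ [mp]; rewrite lte_fin => um; rewrite -EFinB lte_fin.
    have p0 : 0 < p by rewrite -(pmulr_rgt0 _ s0) -mp.
    nra.
  by rewrite mulry gtr0_sg // mul1e.
have inv1 : (s : R)^-1 @[s --> (1:R)] --> (1 : R).
  by rewrite -[X in _ --> X]invr1; apply: cvgV => //; exact: oner_neq0.
have tubeV : \forall s \near (1 : R), K `<=` [set x | U (s^-1 * x)].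
  exact: inv1 tube.
have n1 : \forall s \near (1 : R), 3 / 4 < s < 4 / 3.
  near=> s; apply/andP; split; near: s; [apply: lt_nbhsr|apply: lt_nbhsl]; lra.
have n2 : \forall s \near (1 : R), 3 / 4 < s^-1 < 4 / 3.
  exact: inv1 n1.
near=> s.
apply: contrapT => nx.
have sb : 3 / 4 < s < 4 / 3 by near: s.
have k1 : (lebesgue_measure (K `\` ( *%R s @^-1` K)) < (m / 2)%:E)%E.
  by apply: key => //; near: s.
have k2 : (lebesgue_measure (K `\` ( *%R s^-1 @^-1` K)) < (m / 2)%:E)%E.
  apply: key; first by near: s.
  by rewrite invrK; near: s.
have mP r : measurable ( *%R r @^-1` K : set (measurableTypeR R)).
  by rewrite -[X in measurable X]setTI; exact: measurable_realfun.mulrl_measurable.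
have : (lebesgue_measure K <= lebesgue_measure (K `\` ( *%R s @^-1` K))
    + lebesgue_measure (K `\` ( *%R s^-1 @^-1` K)))%E.
  apply: le_trans (measureU2 _ _ _); try exact: measurableD.
  apply: le_measure; rewrite ?inE //.
    by apply: measurableU; exact: measurableD.
  move=> x Kx; apply: contrapT => /not_orP [h1 h2]; apply: nx; exists x; split.
  - exact: KE.
  - by apply: KE; apply: contrapT => h; apply: h1.
  - by apply: KE; apply: contrapT => h; apply: h2.
rewrite leNgt => /negP; apply.
by rewrite Km (splitr m) EFinD lteD.
Unshelve. all: by end_near.
Qed.

(** * Rational dilations along which the functional equation holds *)

Lemma negligible_bigcup_count d (T : sigmaRingType d) (R : realFieldType)
    (mu : {measure set T -> \bar R}) (I : countType) (F : I -> set T) :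
  (forall i, mu.-negligible (F i)) -> mu.-negligible (\bigcup_i F i).
Proof.
move=> F0; pose G k := if unpickle k is Some i then F i else set0.
apply: (@negligibleS _ _ _ _ (\bigcup_k G k)).
  by move=> x [i _ Fx]; exists (pickle i) => //; rewrite /G pickleK.
apply: negligible_bigcup => k; rewrite /G.
by case: (unpickle k) => [i|]; [exact: F0|exact: negligible_set0].
Qed.

(** This form absorbs the case distinction in [ResCFE]: when [D] is null, it contains all the
    exceptional points itself. *)
Lemma ResCFE_ae (R : realType) (kappa : R) (B : set R) (g : R -> R) (s : R) :
  ResCFE kappa B g -> 0 < s ->
  lebesgue_null [set b | [/\ B b, B (s * b) & g (s * b) <> s `^ kappa * g b]].
Proof.
move=> gCFE s0; set D := B `&` [set b * s^-1 | b in B].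
have inD b : B b -> B (s * b) -> D b.
  move=> Bb Bsb; split => //; exists (s * b) => //.
  by rewrite mulrAC mulfV ?mul1r ?gt_eqF.
have [D0|/(gCFE s s0)[M M0 gM]] := pselect (lebesgue_null D).
  by apply: negligibleS D0 => b [Bb Bsb _]; exact: inD.
apply: negligibleS M0 => b [Bb Bsb ne]; apply: contrapT => nM.
by apply: ne; apply: gM; split => //; exact: inD.
Qed.

(** [E n] collects the points of [B] for which no rational in ]1, [e_ n][ works. Were it non-null,
    [nonnull_dilates_meet] at such a rational q close to 1 would give x in [E n] with q x and x / q
    in [E n], hence in [B], a contradiction. *)
Lemma ae_rational_dilations (R : realType) (B : set R) : measurable B ->
  {ae @lebesgue_measure R, forall b, B b -> forall e : R, 1 < e ->
    exists q : rat, [/\ 1 < (ratr q : R) < e, B (ratr q * b) & B ((ratr q)^-1 * b)]}.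
Proof.
move=> mB.
pose e_ n : R := 1 + n.+1%:R^-1.
pose good n (q : rat) := 1 < (ratr q : R) < e_ n.
pose E n := B `\` \bigcup_(q : rat) (if good n q then
  ( *%R (ratr q : R) @^-1` B) `&` ( *%R (ratr q : R)^-1 @^-1` B) else set0).
have mP r : measurable ( *%R r @^-1` B : set (measurableTypeR R)).
  rewrite -[X in measurable X]setTI.
  exact: measurable_realfun.mulrl_measurable.
have mE n : measurable (E n : set (measurableTypeR R)).
  apply: measurableD => //; apply: bigcupT_measurable_rat => q.
  by case: ifP => _ //; apply: measurableI.
have E0 n : lebesgue_null (E n).
  apply/negligibleP => //; apply/eqP; apply: contrapT => /negP.
  move=> /(nonnull_dilates_meet (mE n)) /nbhs_ballP[d /= d0 near1].
  have : 1 < Num.min (1 + d) (e_ n).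
    by rewrite lt_min !ltrDl d0 invr_gt0 ltr0n.
  move=> /rat_in_itvoo[q]; rewrite in_itv /= lt_min => /and3P[q1 qd qe].
  have [|x [[Bx nx] [Bqx _] [Bqx' _]]] := near1 (ratr q).
    by rewrite /ball /= ltr_distlC; apply/andP; split; lra.
  by apply: nx; exists q => //; rewrite /good q1 qe.
apply: negligibleS (negligible_bigcup E0).
move=> b /= nb; apply: contrapT => nE; apply: nb => Bb e e1.
have [n ne] : exists n, e_ n < e.
  have e0 : 0 < e - 1 by rewrite subr_gt0.
  have [n _ /(_ n (leqnn n)) /=] := near_infty_natSinv_lt (PosNum e0).
  by move=> ne; exists n; rewrite /e_ addrC -ltrBrDr.
apply: contrapT => nq; apply: nE; exists n => //; split => // -[q _].
case: ifP => // /andP[q1 qn] [Bqb Bqb']; apply: nq; exists q; split => //.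
by rewrite q1 (lt_trans qn).
Qed.

(** The equation is assumed on [B] but the dilations stay in a measurable part [A], so that one
    statement serves both [B] and [B0]. *)
Lemma ResCFE_rational_dilations (R : realType) (kappa : R) (B A : set R)
    (g : R -> R) :
  ResCFE kappa B g -> A `<=` B -> A `<=` `]0, +oo[ -> measurable A ->
  constant_along_rational_dilations kappa A g.
Proof.
move=> gCFE AB A0 mA.
have mu_filter := ae_filter_ringOfSetsType (@lebesgue_measure R).
have aeg : {ae @lebesgue_measure R, forall b, forall q : rat, 0 < q ->
    A b -> A (ratr q * b) -> g (ratr q * b) = ratr q `^ kappa * g b}.
  pose N (q : rat) : set R := [set b | [/\ 0 < q, A b, A (ratr q * b) &
    g (ratr q * b) <> ratr q `^ kappa * g b]].
  suff N0 q : lebesgue_null (N q).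
    apply: negligibleS (negligible_bigcup_count N0).
    move=> b /= nb; apply: contrapT => nN; apply: nb => q q0 Ab Aqb.
    by apply: contrapT => ne; apply: nN; exists q.
  have [q0|q0] := ltP 0 q; last first.
    rewrite (_ : N q = set0); first exact: negligible_set0.
    by rewrite -subset0 => b [] /lt_geF; rewrite q0.
  have sq0 : 0 < (ratr q : R) by rewrite ltr0q.
  apply: negligibleS (ResCFE_ae gCFE sq0) => b [_ Ab Aqb ne].
  by split => //; exact: AB.
have aeq := ae_rational_dilations mA.
apply: filterS2 aeg aeq => b gb qb Ab.
have b0 : 0 < b by have := A0 _ Ab; rewrite /= in_itv /= andbT.
(* From an index and the previous term, [F] picks a smaller rational above 1 that is also within the
   prescribed distance of 1; outside the case 1 < [np.2] its value is arbitrary. *)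
have /choice[F FP] : forall np : nat * rat, exists q : rat, 1 < np.2 ->
    [/\ 1 < q, q < np.2, (ratr q : R) < 1 + np.1.+1%:R^-1,
      A (ratr q * b) & A ((ratr q)^-1 * b)].
  move=> [n p] /=; have [p1|p1] := ltP 1 p; last by exists 0.
  have [|q [/andP[q1]]] := qb Ab (Num.min (ratr p) (1 + n.+1%:R^-1)).
    by rewrite lt_min ltrDl invr_gt0 ltr0n -[X in X < _](rmorph1 (@ratr R)) ltr_rat p1.
  rewrite lt_min => /andP[qp qn Aq Aq']; exists q => _; split => //.
    by rewrite -(ltr_rat R) rmorph1.
  by rewrite -(ltr_rat R).
(* Passing the previous term to [F] forces strict decrease; 2 is only an initial upper bound. *)
pose p := fix p n := if n is m.+1 then F (n, p m) else F (0, 2).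
have pP n : [/\ 1 < p n, (ratr (p n) : R) < 1 + n.+1%:R^-1,
      A (ratr (p n) * b) & A ((ratr (p n))^-1 * b)] /\ p n.+1 < p n.
  have p1 : 1 < p n.
    by elim: n => [|n IH]; [have [] := FP (0%N, 2) isT|have [] := FP (n.+1, p n) IH].
  split; last by have [] := FP (n.+1, p n) p1.
  case: n p1 => [|n] p1; first by have [] := FP (0%N, 2) isT.
  have pn1 : 1 < p n.
    by elim: n {p1} => [|n IH]; [have [] := FP (0%N, 2) isT|have [] := FP (n.+1, p n) IH].
  by have [] := FP (n.+1, p n) pn1.
pose q n := if odd n then (p n./2)^-1 else p n./2.
have q_even n : q n.*2 = p n by rewrite /q odd_double doubleK.
have q_odd n : q n.*2.+1 = (p n)^-1.
  by rewrite /q /= odd_double /= uphalf_double.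
exists q; split.
- apply/cvgrPdist_lt => e e0.
  have [n _ ne] := near_infty_natSinv_lt (PosNum e0).
  exists n.*2 => //= m nm.
  have nm2 : (n <= m./2)%N by rewrite -(doubleK n) half_leq.
  have [[p1 pe _ _] _] := pP m./2.
  have /= {}ne := ne _ nm2.
  have rp1 : 1 < (ratr (p m./2) : R) by rewrite -(rmorph1 (@ratr R)) ltr_rat.
  have pe' : ratr (p m./2) - 1 < e.
    by apply: lt_trans ne; rewrite ltrBlDl.
  rewrite /q; case: ifP => _; last by rewrite distrC gtr0_norm // subr_gt0.
  rewrite fmorphV gtr0_norm; last by rewrite subr_gt0 invf_lt1 // (lt_trans _ rp1).
  apply: le_lt_trans pe'.
  set r : R := ratr _ in rp1 *.
  have r0 : 0 < r by exact: lt_trans rp1.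
  (* The inverse terms are no farther from 1 than the terms themselves, since (r - 1) / r <= r - 1
     for r > 1. *)
  have -> : 1 - r^-1 = (r - 1) / r by rewrite mulrBl mul1r divff // gt_eqF.
  by rewrite ler_pdivrMr // ler_peMr ?subr_ge0 // ltW.
- move=> n.
  have [[p1 pe Ap Ap'] _] := pP n./2.
  have p0 : 0 < p n./2 by exact: lt_trans p1.
  have [q0 Aq] : 0 < q n /\ A (ratr (q n) * b).
    by rewrite /q; case: ifP => _; split => //; rewrite ?invr_gt0 // fmorphV.
  have gq := gb _ q0 Ab Aq.
  have rq0 : 0 < (ratr (q n) : R) by rewrite ltr0q.
  split => //; rewrite (mulrC b) gq (powRM _ (ltW rq0) (ltW b0)) -mulf_div divff ?mul1r //.
  by rewrite gt_eqF // powR_gt0.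
- apply/decreasing_seqP => n; rewrite !q_even.
  by have [] := pP n.
- apply/increasing_seqP => n; rewrite !q_odd.
  have [[p1 _ _ _] pn] := pP n; have [[p1' _ _ _] _] := pP n.+1.
  by rewrite ltf_pV2 // posrE (lt_trans ltr01).
- by move=> n; rewrite q_odd q_even.
Qed.

(** * Regular variation in additive form *)

Lemma limn_esup_pinfty (R : realType) (u : nat -> R) (M : R) (N : nat) :
  limn_esup (fun n => (u n)%:E) = +oo%E -> exists n, (N <= n)%N /\ M < u n.
Proof.
move=> uoo; have : (M%:E < limn_esup (fun n => (u n)%:E))%E by rewrite uoo ltry.
rewrite /limn_esup limf_esupE => Mu.
have /(lt_le_trans Mu)/ereal_sup_gt[_ [n /= Nn <-]] :
    (ereal_inf [set ereal_sup [set (u n)%:E | n in V] | V in \oo] <=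
     ereal_sup [set (u n)%:E | n in [set n | (N <= n)%N]])%E.
  by apply: ereal_inf_lbound; exists [set n | (N <= n)%N] => //; exists N.
by rewrite lte_fin => Mun; exists n.
Qed.

Lemma limn_esup_lt (R : realType) (u : nat -> R) (M l : R) :
  limn_esup (fun n => (u n)%:E) = l%:E -> l < M -> \forall n \near \oo, u n < M.
Proof.
move=> ul lM; have : (limn_esup (fun n => (u n)%:E) < M%:E)%E.
  by rewrite ul lte_fin.
rewrite /limn_esup limf_esupE => /ereal_inf_lt[_ [V [N _ NV] <-]] VM.
exists N => // n Nn; rewrite -lte_fin; apply: le_lt_trans VM.
by apply: ereal_sup_ubound; exists n => //; exact: NV.
Qed.

(** The sequence need not be monotone. Take the least index past both thresholds at which [t]
    reaches [y]: by the choice of [T] it is not the first one, so its predecessor lies below [y] and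
    the gap bound applies. *)
Lemma small_gaps_locate (R : realType) (t : nat -> R) (N : nat) (d : R) :
  (forall M N, exists n, (N <= n)%N /\ M < t n) ->
  (\forall n \near \oo, t n.+1 - t n < d) ->
  exists T, forall y, T < y -> exists n, [/\ (N <= n)%N, y <= t n & t n < y + d].
Proof.
move=> tM [N' _ gap]; exists (t (maxn N N')) => y Ty.
have exn : exists n, (maxn N N' <= n)%N && (y <= t n).
  by have [n [Nn yn]] := tM y (maxn N N'); exists n; rewrite Nn ltW.
case: (ex_minnP exn) => n /andP[Nn yn] min_n.
move: Nn; rewrite leq_eqVlt => /predU1P[nE|].
  by move: Ty; rewrite nE ltNge yn.
case: n yn min_n => // n yn min_n; rewrite ltnS => Nn.
have tny : t n < y.
  rewrite ltNge; apply/negP => ytn.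
  by have := min_n n; rewrite Nn ytn ltnn => /(_ isT).
move: Nn; rewrite geq_max => /andP[Nn /gap /= gn].
by exists n.+1; split => //; [exact: leqW|lra].
Qed.

(* Baire category: the closed sets of points from which the convergence is
   e-good cover an interval, so one of them contains an interval. *)
Lemma pointwise_cvg_unif_on_itv (R : realType) (H : nat -> R -> R) (p q e : R) :
  p < q -> 0 < e -> (forall n, continuous (H n)) ->
  (forall u, p < u < q -> H n u @[n --> \oo] --> (0 : R)) ->
  exists (N : nat) (a b : R), a < b /\
    forall n u, (N <= n)%N -> a < u < b -> `|H n u| <= e.
Proof.
move=> pq e0 cH H0.
pose F N : set R := \bigcap_(n in [set n | (N <= n)%N]) [set u | `|H n u| <= e].
have cF N : closed (F N).
  apply: closed_bigI => n _.
  rewrite (_ : mkset _ = (fun u => `|H n u|) @^-1` [set x | x <= e]) //.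
  apply: closed_comp; last exact: closed_le.
  move=> u _; apply: (@continuous_comp _ _ _ (H n) (fun x => `|x|)).
    exact: cH.
  exact: norm_continuous.
have [N [U [[u Uu] oU UF]]] : exists N (U : set R),
    [/\ U !=set0, open U & U `<=` F N].
  apply: contrapT => nF.
  have dF : forall N, open (~` F N) /\ dense (~` F N).
    move=> N; split; first exact: closed_openC.
    move=> U U0 oU; apply: contrapT => UF; apply: nF; exists N, U; split => //.
    by move=> u Uu; apply: contrapT => Fu; apply: UF; exists u.
  have pq0 : `]p, q[%classic !=set0.
    by exists ((p + q) / 2); rewrite /= in_itv /=; apply/andP; split; lra.
  have [u []] := Baire dF pq0 (@interval_open _ (BRight p) (BLeft q) isT isT).
  rewrite /= in_itv /= => /H0 /cvgrPdist_le /(_ _ e0) [N _ Hu] /(_ N I); apply.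
  move=> n /= Nn.
  by have := Hu n Nn; rewrite /= sub0r normrN.
have /nbhs_ballP[r /= r0 rU] : nbhs u U by exact: open_nbhs_nbhs.
exists N, (u - r), (u + r); split; first by lra.
move=> n v Nn vr; have /UF : U v by apply: rU; rewrite /ball /= ltr_distlC.
by apply.
Qed.

Section kendall_additive.
Variables (R : realType) (h : R -> R) (t al : nat -> R) (p q : R).
Hypotheses (pq : p < q) (ch : continuous h).
Hypothesis t_unbounded : forall M N, exists n, (N <= n)%N /\ M < t n.
Hypothesis t_gaps : forall d, 0 < d -> \forall n \near \oo, t n.+1 - t n < d.
Hypothesis ht : forall u, p < u < q -> h (t n + u) + al n @[n --> \oo] --> (0 : R).

(** Every large [y] is some [t n + u] with u in the interval ]a, b[ on which convergence is uniform.
    Comparing [y] and [y + s] through the same n eliminates the unknown [al n], at the cost of one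
    [e] for each point. *)
Lemma kendall_uniform_continuity e : 0 < e -> exists d T : R, 0 < d /\
  forall y s, T < y -> `|s| < d -> `|h (y + s) - h y| <= 2 * e.
Proof.
move=> e0; have cH n : continuous (fun u => h (t n + u) + al n).
  move=> u; apply: cvgD; last exact: cvg_cst.
  apply: continuous_comp; last exact: ch.
  by apply: cvgD; [exact: cvg_cst|exact: cvg_id].
have [N [a [b [ab Hab]]]] := pointwise_cvg_unif_on_itv pq e0 cH ht.
(* A quarter of the length: [y - t n] lies within [d] of the midpoint of ]a, b[, and a further shift
   by less than [d] stays inside. *)
pose d := (b - a) / 4; have d0 : 0 < d by rewrite /d; lra.
have [T TP] := small_gaps_locate N t_unbounded (t_gaps d0).
exists d, (T + (a + b) / 2); split => // y s Ty sd.
have [|n [Nn yn nd]] := TP (y - (a + b) / 2); first by lra.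
have /ltr_normlP[s1 s2] := sd.
have := Hab n (y - t n) Nn; have := Hab n (y + s - t n) Nn.
rewrite ![t n + _]addrC !subrK => Hs H0.
have /ler_normlP[k1 k2] : `|h (y + s) + al n| <= e.
  by apply: Hs; rewrite /d in d0 nd s1 s2; apply/andP; split; lra.
have /ler_normlP[k3 k4] : `|h y + al n| <= e.
  by apply: H0; rewrite /d in d0 nd s1 s2; apply/andP; split; lra.
by apply/ler_normlP; split; lra.
Qed.

Let vanish d := forall e, 0 < e ->
  exists T, forall y, T < y -> `|h (y + d) - h y| < e.

(** The points [u1] and [u2] = [u1] + [d] are symmetric about the midpoint of ]p, q[, and both lie
    in it when [d] is short. The hypothesis [ht] at these points compares h (t n + u1) with h (t n +
    u2), and uniform continuity moves this to [y] and [y + d]. The errors add up to 2 (e/8) + 2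
    (2e/8) < e. *)
Let vanish_small d : `|d| < q - p -> vanish d.
Proof.
move=> /ltr_normlP[d1 d2] e e0.
pose u1 := (p + q - d) / 2; pose u2 := (p + q + d) / 2.
have u1pq : p < u1 < q by rewrite /u1; apply/andP; split; lra.
have u2pq : p < u2 < q by rewrite /u2; apply/andP; split; lra.
have e8 : 0 < e / 8 by rewrite divr_gt0.
have [dl [T0 [dl0 Hs]]] := kendall_uniform_continuity e8.
have /cvgrPdist_lt /(_ _ e8) [N1 _ H1] := ht u1pq.
have /cvgrPdist_lt /(_ _ e8) [N2 _ H2] := ht u2pq.
have [T TP] := small_gaps_locate (maxn N1 N2) t_unbounded (t_gaps dl0).
exists (Num.max (T + u1) (Num.max T0 (T0 - d))) => y.
rewrite !gt_max => /and3P[y1 y2 y3].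
have [|n [Nn yn nd]] := TP (y - u1); first by lra.
move: Nn; rewrite geq_max => /andP[/H1 /= h1 /H2 /= h2].
have sE : `|t n + u1 - y| < dl.
  by rewrite ger0_norm; lra.
have y3' : T0 < y + d by lra.
have := Hs _ _ y2 sE; have := Hs _ _ y3' sE.
rewrite (_ : y + (t n + u1 - y) = t n + u1); last by ring.
rewrite (_ : y + d + (t n + u1 - y) = t n + u2); last by rewrite /u1 /u2; field.
move=> /ler_normlP[k1 k2] /ler_normlP[k3 k4].
move: h1 h2; rewrite !sub0r !normrN => /ltr_normlP[k5 k6] /ltr_normlP[k7 k8].
by apply/ltr_normlP; split; lra.
Qed.

Lemma kendall_additive d : h (y + d) - h y @[y --> +oo] --> (0 : R).
Proof.
suff vd : vanish d.
  apply/cvgrPdist_lt => e /vd[T TP]; exists T; split; first exact: num_real.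
  by move=> y /TP; rewrite sub0r normrN.
(* An arbitrary [d] is cut into k + 1 equal steps shorter than q - p; the increments of [h] over the
   steps add up. *)
have [k kd] : exists k : nat, `|d| / (q - p) < k.+1%:R.
  exists (Num.truncn (`|d| / (q - p))); exact: truncnS_gt.
have qp : 0 < q - p by rewrite subr_gt0.
have vk : vanish (d / k.+1%:R).
  apply: vanish_small; rewrite normrM normfV (ger0_norm (ler0n _ _)).
  by rewrite ltr_pdivrMr ?ltr0n // mulrC -ltr_pdivrMr.
have kn0 : k.+1%:R != 0 :> R by rewrite pnatr_eq0.
rewrite -(divfK kn0 d) mulr_natr.
elim: {kd kn0}k.+1 (d / _) vk => [|n IH] d2 vd2 e e0.
  by exists 0 => y _; rewrite mulr0n addr0 subrr normr0.
have e2 : 0 < e / 2 by rewrite divr_gt0.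
have [T1 h1] := IH _ vd2 _ e2; have [T2 h2] := vd2 _ e2.
pose d1 := d2 *+ n.
exists (Num.max T1 (T2 - d1)) => y; rewrite gt_max => /andP[y1 y2].
have y2' : T2 < y + d1 by lra.
rewrite mulrS -/d1 (addrC d2) addrA.
have /ltr_normlP[k1 k2] := h1 _ y1; have /ltr_normlP[k3 k4] := h2 _ y2'.
by apply/ltr_normlP; split; lra.
Qed.

End kendall_additive.

(** * Regular variation in multiplicative form *)

Lemma cvgy_ln (R : realType) : ln y @[y --> +oo] --> (+oo : set_system R).
Proof.
apply/cvgryPgt => A; exists (expR A); split; first exact: num_real.
move=> y Ay; rewrite -(expRK A) ltr_ln ?posrE ?expR_gt0 //.
exact: lt_trans (expR_gt0 A) Ay.
Qed.

Lemma cvgy_mull (R : realType) (l : R) : 0 < l ->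
  l * y @[y --> +oo] --> (+oo : set_system R).
Proof.
move=> l0; apply/cvgryPgt => A; exists (A / l); split; first exact: num_real.
by move=> y; rewrite ltr_pdivrMr // mulrC.
Qed.

Lemma nbhs_pinfty_pos (R : realType) : \forall y \near +oo, 0 < (y : R).
Proof. by exists 0; split; first exact: num_real. Qed.

Lemma kendall (R : realType) (kappa c : R) (J : set R) (f : R -> R)
    (x a : nat -> R) :
  open J -> J !=set0 -> J `<=` `]0, +oo[ -> 0 < c ->
  positive_on `]0, +oo[ f -> {within `]0, +oo[, continuous f} ->
  mult_admissible x -> (forall n, 0 < a n) ->
  (forall l, J l -> a n * f (l * x n) @[n --> \oo] --> c * l `^ kappa) ->
  regularly_varying kappa f.
Proof.
move=> oJ [l0 Jl0] J0 c0 fpos fcont [x0 xoo xgap] a0 afJ s s0.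
have pos y : 0 < y -> `]0, +oo[%classic y by move=> y0; rewrite /= in_itv /= y0.
have posJ l : J l -> 0 < l by move=> /J0; rewrite /= in_itv /= andbT.
have f0 y : 0 < y -> 0 < f y by move=> y0; apply/fpos/pos.
(* With these normalisations h (t n + u) + al n is the logarithm of a n f (e^u x n) divided by its
   limit c (e^u)^kappa, so it tends to 0 when e^u is in [J]. *)
pose h u := ln (f (expR u)) - kappa * u.
pose t n := ln (x n).
pose al n := ln (a n) + kappa * t n - ln c.
have fc u : {for expR u, continuous f}.
  have := fcont; rewrite continuous_open_subspace; last exact: interval_open.
  by apply; rewrite inE; exact/pos/expR_gt0.
have ch : continuous h.
  move=> u; apply: cvgB; last exact: mulrl_continuous.
  apply: (@continuous_comp _ _ _ (f \o expR) (@ln R)).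
    by apply: continuous_comp; [exact: continuous_expR|exact: fc].
  exact/continuous_ln/f0/expR_gt0.
have t_unbounded M N : exists n, (N <= n)%N /\ M < t n.
  have [n [Nn Mx]] := limn_esup_pinfty (expR M) N xoo.
  by exists n; split => //; rewrite -(expRK M) ltr_ln ?posrE ?expR_gt0.
have t_gaps d : 0 < d -> \forall n \near \oo, t n.+1 - t n < d.
  move=> d0; have e1 : 1 < expR d by rewrite expR_gt1.
  have := limn_esup_lt xgap e1; apply: filterS => n xn.
  by rewrite -ln_div ?posrE // -(expRK d) ltr_ln ?posrE ?expR_gt0 ?divr_gt0.
have [p [q [pq pqJ]]] : exists p q : R, p < q /\ forall u, p < u < q -> J (expR u).
  have /nbhs_ballP[r /= r0 rJ] : nbhs (ln l0) (expR @^-1` J).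
    apply: continuous_expR; rewrite lnK ?posrE ?posJ //.
    exact: open_nbhs_nbhs.
  exists (ln l0 - r), (ln l0 + r); split; first by lra.
  by move=> u ur; apply: rJ; rewrite /ball /= ltr_distlC.
have ht u : p < u < q -> h (t n + u) + al n @[n --> \oo] --> (0 : R).
  move=> /pqJ Ju; have E n : h (t n + u) + al n =
      ln (a n * f (expR u * x n)) - ln (c * expR u `^ kappa).
    rewrite /h /al expRD lnK ?posrE // (mulrC (x n)).
    rewrite !lnM ?posrE ?powR_gt0 ?expR_gt0 ?f0 ?mulr_gt0 ?expR_gt0 //.
    by rewrite ln_powR expRK; ring.
  rewrite (funext E) -(subrr (ln (c * expR u `^ kappa))).
  apply: cvgB; last exact: cvg_cst.
  apply: (@continuous_cvg _ _ _ _ _ _ (@ln R)); last exact: afJ.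
  by apply: continuous_ln; rewrite mulr_gt0 ?powR_gt0 ?expR_gt0.
have hs := kendall_additive pq ch t_unbounded t_gaps ht (ln s).
(* Exponentiating undoes the change of coordinates: the increment of [h] over ln s is ln (f (s y) /
   f y) - kappa ln s. *)
have hsy : expR (h (ln y + ln s) - h (ln y)) * s `^ kappa @[y --> +oo]
    --> expR 0 * s `^ kappa.
  apply: cvgMr_tmp; apply: (@continuous_cvg _ _ _ _ _ _ (@expR R)).
    exact: continuous_expR.
  exact: (cvg_comp _ _ (@cvgy_ln R) hs).
rewrite expR0 mul1r in hsy; apply: cvg_trans hsy; apply: near_eq_cvg.
have := @nbhs_pinfty_pos R; apply: filterS => y y0.
have -> : ln y + ln s = ln (s * y) by rewrite addrC lnM ?posrE.
rewrite /h !lnK ?posrE ?mulr_gt0 // lnM ?posrE //.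
set F := ln (f (s * y)).
have -> : F - kappa * (ln s + ln y) - (ln (f y) - kappa * ln y) =
    F - ln (f y) - kappa * ln s by ring.
rewrite !expRB /F !lnK ?posrE ?f0 ?mulr_gt0 // -ln_powR lnK ?posrE ?powR_gt0 //.
by rewrite divfK // gt_eqF // powR_gt0.
Qed.

(** * The functional equation on open sets *)

Lemma open_null_set0 (R : realType) (U : set R) :
  open U -> lebesgue_null U -> U = set0.
Proof.
move=> oU U0; rewrite -subset0 => u Uu.
have /nbhs_ballP[r /= r0 rU] : nbhs u U by exact: open_nbhs_nbhs.
have b0 : lebesgue_null (ball u r) by apply: negligibleS U0.
have : lebesgue_measure (ball u r) = 0%E.
  by apply: measure_negligible => //; exact: measurable_realfun.measurable_ball.
rewrite lebesgue_measure_ball ?ltW //.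
by move=> [] /eqP; rewrite mulrn_eq0 /= gt_eqF.
Qed.

(** For s = m / l the defect [phi] of the equation is continuous at [l]. If it were nonzero there,
    it would be nonzero on a whole ball around [l], whereas [ResCFE_ae] makes the set of failures
    null. *)
Lemma ResCFE_open (R : realType) (kappa : R) (B J : set R) (g : R -> R) :
  {within B, continuous g} -> ResCFE kappa B g ->
  open J -> J `<=` B -> J `<=` `]0, +oo[ ->
  forall l m, J l -> J m -> g m = (m / l) `^ kappa * g l.
Proof.
move=> gcont gCFE oJ JB J0 l m Jl Jm.
have posJ y : J y -> 0 < y by move=> /J0; rewrite /= in_itv /= andbT.
have cg y : J y -> {for y, continuous g}.
  move=> Jy; have := continuous_subspaceW JB gcont.
  by rewrite continuous_open_subspace //; apply; rewrite inE.
pose s := m / l; have s0 : 0 < s by rewrite divr_gt0 ?posJ.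
have sl : s * l = m by rewrite divfK // gt_eqF ?posJ.
pose phi y := g (s * y) - s `^ kappa * g y.
have cphi : {for l, continuous phi}.
  apply: cvgB; last by apply: cvgMl_tmp; exact: cg.
  apply: (@continuous_comp _ _ _ (fun y => s * y) g).
    exact: mulrl_continuous.
  by apply: cg; rewrite sl.
apply: contrapT => ne; have phi0 : phi l != 0.
  by rewrite /phi sl subr_eq0; apply/eqP.
have near_ne : \forall y \near l, [/\ J y, J (s * y) & phi y != 0].
  have n1 : \forall y \near l, J y by exact: open_nbhs_nbhs.
  have n2 : \forall y \near l, J (s * y).
    apply: (@mulrl_continuous R s l); apply: open_nbhs_nbhs; split => //.
    by rewrite sl.
  have n3 : \forall y \near l, phi y != 0.
    exact: (cvgr_neq0 _ cphi phi0).
  by near=> y; split; near: y.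
move/nbhs_ballP: near_ne => [r /= r0 rP].
suff /open_null_set0 : lebesgue_null (ball l r).
  by move=> /(_ (ball_open l r)) /seteqP[/(_ l (ballxx _ r0))].
apply: negligibleS (ResCFE_ae gCFE s0) => y /rP[Jy Jsy].
by rewrite /phi subr_eq0 => /eqP; split => //; exact: JB.
Unshelve. all: by end_near.
Qed.

(** * Splitting a relatively closed set, and assembling the two parts *)

Lemma rel_closed_pos_measurable (R : realType) (B : set R) :
  rel_closed_pos B -> measurable (B : set (measurableTypeR R)).
Proof.
move=> [C cC ->]; apply: measurableI; first exact: measurable_itv.
exact: measurable_realfun.closed_measurable.
Qed.

(** The positive part [V] of the interior of the closure is open and, [B] being relatively closed,
    lies in [B], hence in its interior. But an open set that meets the closure of the remainder
    contains a point of the remainder, and that point is in [V]. *)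
Lemma rel_closed_pos_nowhere_dense (R : realType) (B : set R) :
  rel_closed_pos B -> nowhere_dense (B `\` B°).
Proof.
move=> [C cC BE] [u /nbhs_interior uN].
pose V := (closure (B `\` B°))° `&` `]0, +oo[%classic.
have oV : open V by apply: openI; [exact: open_interior|exact: interval_open].
have VB : V `<=` B°.
  rewrite -open_subsetE // => v [/interior_subset vc v0].
  rewrite BE; split => //; rewrite ((closure_id C).1 cC).
  by apply: (@closure_subset _ (B `\` B°)) => // w [+ _]; rewrite BE => -[].
have [w [[Bw nBw] wU]] : (B `\` B°) `&` (closure (B `\` B°))° !=set0.
  by apply: (interior_subset (nbhs_singleton uN)).
by apply: nBw; apply: VB; split => //; move: Bw; rewrite BE => -[].
Qed.

Theorem mainTheorem8 (R : realType) (kappa : R) (B : set R) (g : R -> R)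
  (Bclosed : rel_closed_pos B) (Bnonnull : ~ lebesgue_null B)
  (gpos : positive_on B g) (gcont : {within B, continuous g})
  (gCFE : ResCFE kappa B g) :
  (nowhere_dense B -> constant_along_rational_dilations kappa B g)
  /\
  (somewhere_dense B ->
   exists B1 B0 : set R,
     [/\ B = B1 `|` B0,
         open B1,
         nowhere_dense B0,
         forall I : set R, open_interval_component B1 I ->
           exists2 l0 : R, I l0 &
             let c := g l0 / l0 `^ kappa in
             (forall l : R, I l -> g l = c * l `^ kappa)
             /\
             (forall (f : R -> R) (x a : nat -> R),
                positive_on `]0, +oo[ f ->
                {within `]0, +oo[, continuous f} ->
                mult_admissible x ->
                (forall n : nat, 0 < a n) ->
                (forall l : R, I l ->
                   a n * f (l * x n) @[n --> \oo] --> g l) ->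
                regularly_varying kappa f
                /\
                exists ell : R -> R,
                  [/\ slowly_varying ell,
                      asymp_equiv +oo f (fun y : R => y `^ kappa * ell y)
                    & asymp_equiv \oo a
                        (fun n : nat => c * x n `^ (- kappa) / ell (x n))])
       & ~ lebesgue_null B0 -> constant_along_rational_dilations kappa B0 g]).
Proof.
have Bpos : B `<=` `]0, +oo[ by case: Bclosed => C _ ->; exact: subIsetl.
have mB := rel_closed_pos_measurable Bclosed.
split=> [_|_]; first exact: (ResCFE_rational_dilations gCFE).
exists B°, (B `\` B°); split.
- by rewrite setDUK //; exact: interior_subset.
- exact: open_interior.
- exact: rel_closed_pos_nowhere_dense.
- move=> J [oJ _ [l0 Bl0 JE]].
  have Jl0 : J l0 by rewrite JE; exact: connected_component_refl.
  have JB : J `<=` B.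
    rewrite JE; apply: subset_trans (@interior_subset _ B).
    exact: connected_component_sub.
  have Jpos := subset_trans JB Bpos.
  have posJ y : J y -> 0 < y by move=> /Jpos; rewrite /= in_itv /= andbT.
  have l00 := posJ _ Jl0; have lk0 := powR_gt0 kappa l00.
  exists l0 => // c.
  have gJ l : J l -> g l = c * l `^ kappa.
    move=> Jl; rewrite (ResCFE_open gcont gCFE oJ JB Jpos Jl0 Jl).
    rewrite powRM ?invr_ge0 ?ltW ?posJ // -powR_inv1 ?ltW // powRAC.
    by rewrite powR_inv1 ?ltW // /c; ring.
  have c0 : 0 < c by rewrite divr_gt0 // gpos //; exact: JB.
  split=> // f x a fpos fcont xadm a0 afJ.
  have fRV : regularly_varying kappa f.
    apply: (@kendall _ kappa c J f x a) => //; first by exists l0.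
    by move=> l Jl; rewrite -gJ //; exact: afJ.
  have f0 y : 0 < y -> 0 < f y by move=> y0; apply: fpos; rewrite /= in_itv /= y0.
  split=> //.
  (* Sampling f at l0 * y rather than at y makes the last equivalence hold even
     along subsequences on which x does not tend to infinity. *)
  pose ell y := f (l0 * y) / (l0 * y) `^ kappa.
  have ell0 y : 0 < y -> 0 < ell y.
    by move=> y0; rewrite divr_gt0 ?powR_gt0 ?f0 ?mulr_gt0.
  exists ell; split.
  + split=> [y|s s0]; first by rewrite /= in_itv /= andbT => /ell0.
    have sk0 := powR_gt0 kappa s0.
    (* Regular variation of [f] is used along l0 y, which tends to infinity with y. *)
    have : f (s * (l0 * y)) / f (l0 * y) / s `^ kappa @[y --> +oo] -->
        s `^ kappa / s `^ kappa.
      apply: cvgMr_tmp; exact: (cvg_comp _ _ (cvgy_mull l00) (fRV s s0)).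
    rewrite divff ?gt_eqF // => cv; apply: cvg_trans cv; apply: near_eq_cvg.
    have := @nbhs_pinfty_pos R; apply: filterS => y y0.
    have ly0 : 0 < l0 * y by rewrite mulr_gt0.
    rewrite /ell (mulrCA l0) (powRM _ (ltW s0) (ltW ly0)).
    field; rewrite !gt_eqF ?powR_gt0 ?f0 //.
  (* This is regular variation with the dilation factor [l0]: the limit l0^kappa cancels the factor
     built into [ell]. *)
  + have : (f (l0 * y) / f y)^-1 * l0 `^ kappa @[y --> +oo] -->
        (l0 `^ kappa)^-1 * l0 `^ kappa.
      apply: cvgMr_tmp; apply: cvgV; [by rewrite gt_eqF|exact: fRV].
    rewrite mulVf ?gt_eqF // => cv; apply: cvg_trans cv; apply: near_eq_cvg.
    have := @nbhs_pinfty_pos R; apply: filterS => y y0.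
    rewrite /ell (powRM _ (ltW l00) (ltW y0)).
    by field; rewrite !gt_eqF ?powR_gt0 ?f0 ?mulr_gt0.
  + have [x0 _ _] := xadm.
    (* The quotient in question equals a n f (l0 x n) / g l0 exactly, for every n, so the hypothesis
       at the single point [l0] gives its limit. *)
    have : a n * f (l0 * x n) / g l0 @[n --> \oo] --> g l0 / g l0.
      by apply: cvgMr_tmp; exact: afJ.
    have gl0 : 0 < g l0 by apply: gpos; exact: JB.
    rewrite divff ?gt_eqF //; apply: cvg_trans; apply: near_eq_cvg.
    apply: nearW => n.
    rewrite /ell /c powRN (powRM _ (ltW l00) (ltW (x0 n))).
    by field; rewrite !gt_eqF ?powR_gt0 ?f0 ?mulr_gt0.
- move=> _; apply: (ResCFE_rational_dilations gCFE).
  + exact: subDsetl.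
  + by apply: subset_trans Bpos; exact: subDsetl.
  + apply: measurableD => //; apply: measurable_realfun.open_measurable.
    exact: open_interior.
Qed.
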